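(* Let $G$ be a virtually polycyclic group. Then the following two statements are equivalent: (1) the group $G$ is nilpotent; (2) for all subgroups $H\leq G$ and all primes $p$, the pro-$p$ topology of $G$ induces on $H$ its full pro-$p$ topology.
   Context: The (full) pro-$p$ topology of a group $G$ is the topology generated by the cosets of the normal subgroups $U$ of $G$ such that $G/U$ is a finite $p$-group. Saying that the pro-$p$ topology of $G$ induces on $H$ its full pro-$p$ topology means that the subspace topology on $H$ inherited from the pro-$p$ topology of $G$ equals the pro-$p$ topology of $H$; equivalently, the induced map of pro-$p$ completions $H_{\hat p}\to G_{\hat p}$ is injective. *)

(* Defs.v *)
From HB Require Import structures.
From mathcomp Require Import all_boot.
From mathcomp Require Import boolp classical_sets cardinality topology.

Set Implicit Arguments.
Unset Strict Implicit.
Unset Printing Implicit Defensive.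

Local Open Scope classical_set_scope.
Local Open Scope card_scope.
Local Open Scope group_scope.

Section Subgroups.
Variable G : groupType.
Implicit Types U K : set G.

Definition subgroup K : Prop := group_closed [in K].

Definition subgroup_gen (A : set G) : set G := smallest subgroup A.

(* [U] is normalised by [K]; together with [U `<=` K] this is normality in [K]. *)
Definition normalised U K : Prop := forall x g, U x -> K g -> U (x ^ g).

Definition normal_subgroup U K : Prop :=
  [/\ subgroup U, U `<=` K & normalised U K].

Definition left_coset (g : G) U : set G := [set g * u | u in U].

Definition quotient K U : set (set G) := [set left_coset g U | g in K].

Definition cyclic_quotient K U : Prop :=
  exists2 g, K g & forall C, quotient K U C ->
    exists n : nat, C = left_coset (g ^+ n) U \/ C = left_coset (g ^- n) U.

Definition polycyclic K : Prop :=
  exists (n : nat) (F : nat -> set G),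
    [/\ F 0 = [set 1], F n = K,
        forall i, i <= n -> subgroup (F i)
      & forall i, i < n ->
          normal_subgroup (F i) (F i.+1) /\ cyclic_quotient (F i.+1) (F i)].

Fixpoint lower_central (n : nat) : set G :=
  if n is m.+1 then
    subgroup_gen [set z | exists x y : G, lower_central m x /\ z = [~ x, y]]
  else setT.

(* A finite p-group is a group whose order is a power of [p]. *)
Definition finite_p_quotient (p : nat) K U : Prop :=
  exists k : nat, quotient K U #= `I_(p ^ k).

Definition p_cosets (p : nat) : set (set G) :=
  [set C | exists U g, [/\ normal_subgroup U setT,
     finite_p_quotient p setT U & C = left_coset g U]].

End Subgroups.

Definition virtually_polycyclic (G : groupType) : Prop :=
  exists K : set G,
    [/\ subgroup K, finite_set (quotient setT K) & polycyclic K].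

Definition nilpotent (G : groupType) : Prop :=
  exists n : nat, @lower_central G n = [set 1].

(* A copy of [G] carrying the topology generated by [p_cosets G p]. *)
Definition pro_p (p : nat) (G : groupType) : Type := G.

HB.instance Definition _ p (G : groupType) := Choice.copy (pro_p p G) G.
HB.instance Definition _ p (G : groupType) :=
  isSubBaseTopological.Build (pro_p p G) (@p_cosets G p) id.

(* A subgroup of [G] is a [subGroupType], with inclusion [val]; the initial
   topology along [val] is the subspace topology, and the equality is between
   the two collections of open sets on the same carrier [H]. *)
Definition induces_full_pro_p (p : nat) (G : groupType) (S : {pred G})
    (H : subGroupType S) : Prop :=
  @open (initial_topology (val : H -> pro_p p G)) = @open (pro_p p H).

(* Main.v *)
From mathcomp Require Import fingroup cyclic pgroup nilpotent sylow finmap.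
Require Import Defs.
From HB Require Import structures.
From mathcomp Require Import all_boot.
From mathcomp Require Import boolp classical_sets cardinality topology.

(* (1) => (2).  Let N <= H have p-power index and let U be maximal among the
   normal subgroups of G with U ∩ H <= N (Zorn).  If c is central modulo U and
   not in U, then U<c> meets H outside N; applied to powers of c, this forces c
   to have p-power order modulo U.  As G is finitely generated and nilpotent,
   p-torsion climbs the upper central series of G/U, so G/U is a p-group, and it
   is finite because G is virtually polycyclic.

   (2) => (1).  Write L_n for the lower central series.  Since G is virtually
   polycyclic, some e > 0 satisfies x^e in L_{n+1} for all x in L_n, and the same
   e then works for every later factor.  If p does not divide e, each finite
   p-quotient of G therefore kills L_n; but the hypothesis for <x>, with its open
   subgroup <x^p>, detects an x of infinite order in a finite p-quotient, so L_n
   is torsion.  The same argument with x of prime order p shows that the L_k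
   intersect trivially.  A torsion subgroup of G being finite, some L_k is
   trivial. *)

Set Implicit Arguments.
Unset Strict Implicit.
Unset Printing Implicit Defensive.

Local Open Scope classical_set_scope.
Local Open Scope card_scope.
Local Open Scope group_scope.

(** * Congruences modulo a subgroup *)

Section Congruence.
Variable G : groupType.
Implicit Types (x y z g : G) (U V K : set G).

Lemma subgroupP U : subgroup U <->
  [/\ U 1, forall x y, U x -> U y -> U (x * y) & forall x, U x -> U x^-1].
Proof.
have E x : x \in [in U] <-> U x by rewrite !inE.
split=> [[/E U1 UF]|[U1 UM UV]].
- have UV x : U x -> U x^-1.
    by move=> Ux; rewrite -div1g; apply/E/UF; apply/E.
  split=> // x y Ux Uy; rewrite -[y]invgK.
  by apply/E/UF; apply/E => //; apply: UV.
- by split; [exact/E | move=> x y /E Ux /E Uy; apply/E/UM => //; apply: UV].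
Qed.

Lemma subgroup1 U : subgroup U -> U 1.
Proof. by case/subgroupP. Qed.

Lemma subgroupM U x y : subgroup U -> U x -> U y -> U (x * y).
Proof. by case/subgroupP => _ UM _; apply: UM. Qed.

Lemma subgroupV U x : subgroup U -> U x -> U x^-1.
Proof. by case/subgroupP => _ _; apply. Qed.

Lemma subgroupX U x n : subgroup U -> U x -> U (x ^+ n).
Proof.
move=> hU Ux; elim: n => [|n IH]; first exact: subgroup1.
by rewrite expgS; apply: subgroupM.
Qed.

Lemma subgroupVr U x : subgroup U -> U x^-1 -> U x.
Proof. by move=> hU /(subgroupV hU); rewrite invgK. Qed.

Lemma subgroupMl U x y : subgroup U -> U x -> U (x * y) -> U y.
Proof.
by move=> hU Ux Uxy; rewrite -(mulKg x y); apply: subgroupM => //; apply: subgroupV.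
Qed.

Lemma subgroupT : subgroup (@setT G).
Proof. by apply/subgroupP. Qed.

Lemma subgroupI U V : subgroup U -> subgroup V -> subgroup (U `&` V).
Proof.
move=> hU hV; apply/subgroupP; split=> [|x y [? ?] [? ?]|x [? ?]].
- by split; apply: subgroup1.
- by split; apply: subgroupM.
- by split; apply: subgroupV.
Qed.

Definition eqmod U x y : Prop := U (x^-1 * y).

Section Normalised.
Variables U K : set G.
Hypotheses (hU : subgroup U) (hK : subgroup K) (nUK : normalised U K).

Lemma eqmod_refl x : eqmod U x x.
Proof. by rewrite /eqmod mulVg; apply: subgroup1. Qed.

Lemma eqmod_sym x y : eqmod U x y -> eqmod U y x.
Proof. by move=> /(subgroupV hU); rewrite /eqmod invgM invgK. Qed.

Lemma eqmod_trans y x z : eqmod U x y -> eqmod U y z -> eqmod U x z.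
Proof. by move=> xy /(subgroupM hU xy); rewrite -mulgA mulVKg. Qed.

Lemma eqmod_mem x y : eqmod U x y -> U x -> U y.
Proof. by move=> xy Ux; rewrite -(mulVKg x y); apply: subgroupM. Qed.

Lemma eqmodM x x' y y' :
  K y -> eqmod U x x' -> eqmod U y y' -> eqmod U (x * y) (x' * y').
Proof.
move=> Ky xx yy; have := subgroupM hU (nUK xx Ky) yy.
by rewrite /eqmod conjgE invgM !mulgA mulgK.
Qed.

Lemma eqmodV x y : K x -> eqmod U x y -> eqmod U x^-1 y^-1.
Proof.
move=> Kx /(subgroupV hU) xy; have := nUK xy (subgroupV hK Kx).
by rewrite /eqmod conjgE !invgM !invgK !mulgA mulgK.
Qed.

Lemma eqmodX x y n : K x -> eqmod U x y -> eqmod U (x ^+ n) (y ^+ n).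
Proof.
move=> Kx xy; elim: n => [|n IH]; first exact: eqmod_refl.
by rewrite !expgS; apply: eqmodM => //; apply: subgroupX.
Qed.

(** The two elements commute modulo [U]: [comm] moves [y] past the powers of [x], and the usual
    induction on [n] follows. *)
Lemma eqmod_expMn x y n : K x -> K y -> U [~ x, y] ->
  eqmod U ((x * y) ^+ n) (x ^+ n * y ^+ n).
Proof.
move=> Kx Ky Uxy.
have comm m : eqmod U (y * x ^+ m) (x ^+ m * y).
  elim: m => [|m IH]; first by rewrite expg0 mul1g mulg1; apply: eqmod_refl.
  have KX : K (x ^+ m) by apply: subgroupX.
  apply: (@eqmod_trans (x * y * x ^+ m)).
    rewrite expgS mulgA; apply: eqmodM => //; last exact: eqmod_refl.
    have -> : x * y = y * x * [~ x, y] by rewrite -commgC.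
    by rewrite /eqmod mulKg.
  rewrite expgS -!mulgA; apply: eqmodM => //; last exact: eqmod_refl.
  exact: subgroupM.
elim: n => [|n IH]; first by rewrite !expg0 mulg1; apply: eqmod_refl.
have KX m : K (x ^+ m) by apply: subgroupX.
have KY m : K (y ^+ m) by apply: subgroupX.
apply: (@eqmod_trans (x * y * (x ^+ n * y ^+ n))).
  rewrite expgS; apply: eqmodM => //; last exact: eqmod_refl.
  by apply: subgroupX => //; apply: subgroupM.
rewrite [x ^+ n.+1]expgS [y ^+ n.+1]expgS.
have -> : x * y * (x ^+ n * y ^+ n) = x * (y * x ^+ n) * y ^+ n.
  by rewrite !mulgA.
have -> : x * x ^+ n * (y * y ^+ n) = x * (x ^+ n * y) * y ^+ n.
  by rewrite !mulgA.
apply: eqmodM => //; last exact: eqmod_refl.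
apply: eqmodM => //; [by apply: subgroupM | exact: eqmod_refl].
Qed.

End Normalised.

End Congruence.

(** * Polycyclic groups *)

Section Polycyclic.
Variable G : groupType.
Implicit Types (x y z g : G) (U V K F : set G) (D : nat -> set G).

(** The negative case is phrased with [x^-1] instead of a negative power of [g], so that it can be
    treated by passing to the inverse of [x]. *)
Lemma polycyclic_ind (P : set G -> Prop) :
    P [set 1] ->
    (forall F K g, normal_subgroup F K -> subgroup K -> K g ->
       (forall x, K x -> exists n,
          eqmod F (g ^+ n) x \/ eqmod F (g ^+ n) x^-1) ->
       P F -> P K) ->
  forall K, polycyclic K -> P K.
Proof.
move=> P1 PS K [n [F [F0 FnK sF hF]]]; rewrite -FnK.
suff {FnK} PF i : i <= n -> P (F i) by apply: PF.
elim: i => [|i IH] lein; first by rewrite F0.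
have [nF [g Kg cyc]] := hF i lein.
apply: (PS _ _ g nF) => //; [exact: sF | | exact/IH/ltnW].
have [hF' sFK nFK] := nF; have hK := sF _ lein.
move=> x Kx; have [|m [E|E]] := cyc (left_coset x (F i)); first by exists x.
- exists m; left; apply: (eqmod_sym hF').
  have : left_coset x (F i) (g ^+ m).
    by rewrite E; exists 1; rewrite ?mulg1 //; exact: subgroup1.
  by case=> u Fu <-; rewrite /eqmod mulKg.
- exists m; right; rewrite -[g ^+ m]invgK; apply: (@eqmodV _ _ (F i.+1)) => //.
    exact/(subgroupV hK)/(subgroupX _ hK).
  apply: (eqmod_sym hF').
  have : left_coset x (F i) (g ^- m).
    by rewrite E; exists 1; rewrite ?mulg1 //; exact: subgroup1.
  by case=> u Fu <-; rewrite /eqmod mulKg.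
Qed.

(** Finite index, in a form that makes sense also when [U] is not contained in [K]; covers can thus
    be built up along a polycyclic series. *)
Definition finite_cover K U :=
  exists s : seq G, forall x, K x -> exists2 y, y \in s & eqmod U y x.

Lemma finite_quotient_cover K U : subgroup U ->
  finite_set (quotient K U) -> finite_cover K U.
Proof.
move=> hU /finite_seqP[cs Ecs]; exists [seq xget 1 (C : set G) | C <- cs] => x Kx.
have Cx : left_coset x U \in cs.
  by have : quotient K U (left_coset x U) by [exists x]; rewrite Ecs.
exists (xget 1 (left_coset x U)); first exact: (map_f (fun C : set G => xget 1 C)).
have : left_coset x U (xget 1 (left_coset x U)).
  by apply: (xgetPex 1); exists x; exists 1; rewrite ?mulg1 //; apply: subgroup1.
by case=> u Uu <-; apply: (eqmod_sym hU); rewrite /eqmod mulKg.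
Qed.

Lemma finite_cover_trans K F U :
  subgroup F -> subgroup K -> F `<=` K ->
  finite_cover K F -> finite_cover F U -> finite_cover K U.
Proof.
move=> hF hK sFK [s sP] [t tP]; exists [seq y * z | y <- s, z <- t] => x Kx.
have [y ys yx] := sP x Kx; have [z zt zx] := tP _ yx.
by exists (y * z); [apply: allpairs_f | rewrite /eqmod invgM -mulgA].
Qed.

Definition generated_by K (s : seq G) :=
  forall E, subgroup E -> (forall y, y \in s -> E y) -> K `<=` E.

Lemma polycyclic_fg K : polycyclic K -> exists s, generated_by K s.
Proof.
elim/polycyclic_ind => [|F {}K g _ _ _ cyc [s sP]].
  by exists [::] => E hE _ _ ->; apply: subgroup1.
exists (g :: s) => E hE Es x Kx.
have Eg n : E (g ^+ n) by apply: subgroupX => //; apply: Es; rewrite mem_head.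
have FE : F `<=` E by apply: sP => // y ys; apply: Es; rewrite inE ys orbT.
have [n [/FE|/FE]] := cyc x Kx.
  exact/(subgroupMl hE)/(subgroupV hE).
by move=> /(subgroupMl hE (subgroupV hE (Eg n))) /(subgroupVr hE).
Qed.

Lemma virtually_polycyclic_fg :
  virtually_polycyclic G -> exists s, generated_by (@setT G) s.
Proof.
move=> [K [hK /(finite_quotient_cover hK)[t tP] /polycyclic_fg[s sP]]].
exists (t ++ s) => E hE Es x _; have [y yt yx] := tP x I.
have KE : K `<=` E by apply: sP => // z zs; apply: Es; rewrite mem_cat zs orbT.
apply: (subgroupMl hE _ (KE _ yx)); apply: (subgroupV hE).
by apply: Es; rewrite mem_cat yt.
Qed.

Lemma cyclic_finite_cover F K g d :
  normal_subgroup F K -> subgroup K -> K g ->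
  (forall x, K x -> exists n, eqmod F (g ^+ n) x \/ eqmod F (g ^+ n) x^-1) ->
  0 < d -> F (g ^+ d) -> finite_cover K F.
Proof.
move=> [hF sFK nFK] hK Kg cyc d0 Fgd.
have Kgn n : K (g ^+ n) by apply: subgroupX.
have modd n : eqmod F (g ^+ (n %% d)) (g ^+ n).
  rewrite [in g ^+ n](divn_eq n d) addnC expgnDr /eqmod mulKg mulnC expgnA.
  exact: subgroupX.
exists [seq g ^+ i | i <- iota 0 d] => x Kx.
suff [n nx] : exists n, eqmod F (g ^+ n) x.
  exists (g ^+ (n %% d)); first by apply: map_f; rewrite mem_iota /= ltn_mod.
  exact: (eqmod_trans hF (modd n) nx).
have [n [nx|nx]] := cyc x Kx; first by exists n.
(* Since [g ^+ (n * d)] is in [F], the exponent [n * d.-1] stands for [- n]. *)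
exists (n * d.-1)%N; rewrite -[x]invgK; apply: (@eqmod_trans _ _ hF (g ^- n)).
  apply: (eqmod_sym hF); rewrite /eqmod invgK -expgnDr.
  by rewrite -mulnS prednK // mulnC expgnA; apply: subgroupX.
exact: (eqmodV hF hK nFK).
Qed.

(** Induction along the series of [K]: if [g ^+ d] is in [U], the products of [g ^+ i], for [i < d],
    with representatives of [F] modulo [U] represent [K]. *)
Lemma finite_cover_torsion U : virtually_polycyclic G ->
  normal_subgroup U setT -> (forall x, exists2 d, 0 < d & U (x ^+ d)) ->
  finite_cover setT U.
Proof.
move=> [K [hK /(finite_quotient_cover hK) cK pK]] [hU _ nU] torU.
apply: finite_cover_trans cK _ => //; first exact: subgroupT.
elim/polycyclic_ind: pK => {K hK} [|F K g nFK hK Kg cyc [s sP]].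
  exists [:: 1] => _ ->; exists 1; first exact: mem_head.
  exact: eqmod_refl.
have [d d0 Ud] := torU g; have [hF sFK nF] := nFK.
have Kgn n : K (g ^+ n) by apply: subgroupX.
exists [seq g ^+ i * y | i <- iota 0 d, y <- s] => x Kx.
have modd m : eqmod U (g ^+ (m %% d)) (g ^+ m).
  rewrite [in g ^+ m](divn_eq m d) addnC expgnDr /eqmod mulKg mulnC expgnA.
  exact: subgroupX.
suff [m [z zs zx]] : exists m, exists2 z, z \in s & eqmod U (g ^+ m * z) x.
  exists (g ^+ (m %% d) * z).
    by apply: allpairs_f => //; rewrite mem_iota /= ltn_mod.
  apply: (eqmod_trans hU _ zx).
  by apply: (@eqmodM _ _ setT) => //; exact: eqmod_refl.
have [m [mx|mx]] := cyc x Kx.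
  have [z zs zx] := sP _ mx; exists m, z => //.
  by rewrite /eqmod invgM -mulgA.
have [|z zs zx] := sP (g ^+ m * x).
  have := eqmodV hF hK nF (Kgn m) mx.
  by rewrite invgK /eqmod invgK.
exists (m * d.-1)%N, z => //.
apply: (@eqmod_trans _ _ hU (g ^- m * z)).
  apply: (@eqmodM _ _ setT) => //; last exact: eqmod_refl.
  apply: (eqmod_sym hU); rewrite /eqmod invgK -expgnDr.
  by rewrite -mulnS prednK // mulnC expgnA; apply: subgroupX.
by rewrite /eqmod invgM invgK -mulgA.
Qed.

End Polycyclic.

(** * Descending chains of normal subgroups in a virtually polycyclic group *)

Section DescendingChains.
Variables (G : groupType) (D : nat -> set G).
Hypotheses (nD : forall n, normal_subgroup (D n) setT)
  (decD : forall n, D n.+1 `<=` D n).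
Implicit Types (x y g : G) (F K : set G).

Lemma chain_subgroup n : subgroup (D n). Proof. by have [] := nD n. Qed.

Lemma chain_normalised n : normalised (D n) setT. Proof. by have [] := nD n. Qed.

Lemma chain_leq m n : m <= n -> D n `<=` D m.
Proof.
elim: n => [|n IH]; first by rewrite leqn0 => /eqP->.
rewrite leq_eqVlt => /orP[/eqP-> //|/IH nm].
by move=> x /decD; apply: nm.
Qed.

(** Pigeonhole: among the powers of [x] with exponents from 0 to [size s], two lie in the same coset
    of [K]. Their exponents differ by a positive number at most [size s], which divides the
    factorial. *)
Lemma finite_cover_exponent K : subgroup K -> finite_cover setT K ->
  exists2 f, 0 < f & forall x, K (x ^+ f).
Proof.
move=> hK [s sP]; exists (size s)`!; first exact: fact_gt0.
move=> x; have /choice[c cP] : forall i : nat, exists y,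
    y \in s /\ eqmod K y (x ^+ i).
  by move=> i; have [y] := sP (x ^+ i) I; exists y.
pose t := [seq c i | i <- iota 0 (size s).+1].
have tsize : size t = (size s).+1 by rewrite size_map size_iota.
have : ~~ uniq t.
  apply/negP => ut; have : {subset t <= s}.
    by move=> _ /mapP[i _ ->]; have [] := cP i.
  by move=> /(uniq_leq_size ut); rewrite tsize ltnn.
case/(uniqPn 1) => i [j [ij jt]]; rewrite tsize in jt.
have nthE k : k < (size s).+1 -> nth 1 t k = c k.
  by move=> ks; rewrite (nth_map 0) ?size_iota // nth_iota.
rewrite !nthE ?(ltn_trans ij) // => cij.
have [_ ci] := cP i; have [_ cj] := cP j.
have : eqmod K (x ^+ i) (x ^+ j).
  by apply: (eqmod_trans hK _ cj); rewrite -cij; apply: eqmod_sym.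
rewrite /eqmod -[in x ^+ j](subnKC (ltnW ij)) expgnDr mulKg => Kx.
have /dvdnP[q ->] : j - i %| (size s)`!.
  by apply: dvdn_fact; rewrite subn_gt0 ij (leq_trans (leq_subr _ _)).
by rewrite mulnC expgnA; apply: subgroupX.
Qed.

(* In a cyclic factor [K / F] the images of the [D n] are either eventually
   trivial or all nontrivial; in the second case the image of [D n.+1] has finite
   index in that of [D n], whatever the order of the factor. *)
Lemma chain_exponent : virtually_polycyclic G ->
  exists n e, 0 < e /\ forall x, D n x -> D n.+1 (x ^+ e).
Proof.
move=> [K [hK /(finite_quotient_cover hK) /(finite_cover_exponent hK)[f f0 fP]]].
(* Asking for all [n] from some [n0] on lets the induction raise the bound, so that one [n] serves
   for every factor of the series. *)
move=> pK; suff [n /(_ _ (leqnn n))[e e0 eP]] : exists n0, forall n, n0 <= n ->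
    exists2 e, 0 < e & forall x, D n x -> K x -> D n.+1 (x ^+ e).
  exists n, (f * e)%N; split=> [|x Dx]; first by rewrite muln_gt0 f0.
  by rewrite expgnA; apply: eP (fP x); apply: subgroupX Dx; exact: chain_subgroup.
elim/polycyclic_ind: pK => {K hK f f0 fP} [|F K g [hF sFK nFK] hK Kg cyc].
  exists 0 => n _; exists 1%N => // _ _ ->.
  by apply: subgroup1; exact: chain_subgroup.
move=> [n0 IH].
have [escape|] := pselect
    (forall n, n0 <= n -> exists y, [/\ D n y, K y & ~ F y]); last first.
  move=> /existsNP[n1 /not_implyP[n01 /forallNP noesc]].
  exists n1 => n n1n; have [e e0 eP] := IH n (leq_trans n01 n1n).
  exists e => // x Dx Kx; apply: eP => //; apply: contrapT => Fx.
  by apply: (noesc x); split=> //; apply: chain_leq n1n _ Dx.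
exists n0 => n n0n; have [e e0 eP] := IH n n0n.
have Kgn m : K (g ^+ m) by apply: subgroupX.
have hD m := chain_subgroup m.
have [y [k [Dy Ky k0 yk]]] : exists y k,
    [/\ D n.+1 y, K y, 0 < k & eqmod F (g ^+ k) y].
  have [y [Dy Ky Fy]] := escape _ (leqW n0n).
  have [k [yk|yk]] := cyc y Ky.
    exists y, k; split=> //; case: k yk => // yk.
    by case: Fy; move: yk; rewrite /eqmod invg1 mul1g.
  exists y^-1, k; split=> //; [exact: subgroupV | exact: subgroupV |].
  case: k yk => // yk; case: Fy; apply: (subgroupVr hF).
  by move: yk; rewrite /eqmod invg1 mul1g.
exists (k * e)%N => [|x]; first by rewrite muln_gt0 k0.
suff posx z j : D n z -> K z -> eqmod F (g ^+ j) z -> D n.+1 (z ^+ (k * e)).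
  move=> Dx Kx; have [j [xj|xj]] := cyc x Kx; first exact: posx xj.
  apply: (subgroupVr (hD _)); rewrite -expVgn; apply: posx xj.
    exact: (subgroupV (hD _)).
  exact: subgroupV.
move=> Dz Kz zj.
(* Both sides are [g ^+ (k * j)] modulo [F]. Hence [y ^- j * z ^+ k] lies in [D n] and in [F], where
   [eP] applies, and the factor [y ^- j] is trivial modulo [D n.+1]. *)
have Fzy : eqmod F (y ^+ j) (z ^+ k).
  apply: (@eqmod_trans _ _ hF (g ^+ (k * j))).
    apply: (eqmod_sym hF); rewrite expgnA.
    by apply: (eqmodX hF hK nFK).
  by rewrite mulnC expgnA; apply: (eqmodX hF hK nFK).
have Dyz : D n (y ^- j * z ^+ k).
  apply: (subgroupM (hD n)); last exact: (subgroupX _ (hD n)).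
  exact/(subgroupV (hD n))/(subgroupX _ (hD n))/decD.
rewrite expgnA; apply: (eqmod_mem (hD _) _ (eP _ Dyz Fzy)).
apply: (eqmodX (hD _) (subgroupT G) (@chain_normalised n.+1)) => //.
rewrite /eqmod invgM invgK -mulgA.
have := chain_normalised (subgroupX j (hD n.+1) Dy) (I : setT (z ^+ k)).
by rewrite conjgE.
Qed.

(** As [D n] meets [F] trivially, each coset of [F] holds at most one element of [D n]. If it is not
    1, a later term of the chain omits it, and only finitely many cosets have to be treated. *)
Lemma trivial_on_cover F K n : subgroup F -> F `<=` K ->
  (forall x, x != 1 -> exists n, ~ D n x) ->
  finite_cover K F -> D n `&` F `<=` [set 1] ->
  exists n, D n `&` K `<=` [set 1].
Proof.
move=> hF sFK capD [s sP] Fn.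
suff [m nm mP] : exists2 m, n <= m & forall x y, y \in s -> eqmod F y x ->
    D m x -> x = 1.
  by exists m => x [Dx /sP[y ys yx]]; apply: mP yx Dx.
elim: s {sP} => [|y s [m nm mP]]; first by exists n.
have [[x [Dx yx x1]]|noex] := pselect (exists x, [/\ D n x, eqmod F y x & x != 1]).
  have [m' m'x] := capD x x1; exists (maxn m m').
    by rewrite leq_max nm.
  move=> z y'; rewrite inE => /orP[/eqP-> yz Dz|y's yz Dz]; last first.
    by apply: mP yz (chain_leq _ Dz); rewrite // leq_maxl.
  case: m'x; suff -> : x = z by apply: chain_leq Dz; rewrite leq_maxr.
  apply/esym/divg1_eq; apply: (mulIg x); apply: (mulgI x^-1).
  rewrite mulgVK mul1g mulVg; apply: Fn; split.
    apply: subgroupM; [exact: chain_subgroup|apply: subgroupV => //; exact: chain_subgroup|].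
    by apply: chain_leq Dz; rewrite leq_max nm.
  by apply: (eqmod_trans hF _ yz); apply: eqmod_sym.
exists m => // z y'; rewrite inE => /orP[/eqP-> yz Dz|]; last exact: mP.
apply/eqP/negPn/negP => z1; apply: noex; exists z; split=> //.
exact: chain_leq Dz.
Qed.

(** Along the series, a finite factor is handled by [trivial_on_cover]. When the factor is infinite
    cyclic, the torsion elements of [K] lie in [F], so [D m] gains nothing from [F] to [K]. *)
Lemma chain_trivial m : virtually_polycyclic G ->
  (forall x, x != 1 -> exists n, ~ D n x) ->
  (forall x, D m x -> exists2 d, 0 < d & x ^+ d = 1) ->
  exists n, D n = [set 1].
Proof.
move=> [K [hK /(finite_quotient_cover hK) cK pK]] capD torD.
suff [n nP] : exists n, D n `&` K `<=` [set 1].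
  have [n' n'P] := trivial_on_cover hK (@subsetT _ K) capD cK nP.
  exists n'; apply/seteqP; split=> [x Dx|_ ->]; first exact: n'P.
  by apply: subgroup1; exact: chain_subgroup.
elim/polycyclic_ind: pK => {K hK cK} [|F K g nFK hK Kg cyc [n nP]].
  by exists 0 => _ [_ ->].
have [hF sFK _] := nFK.
have [[d d0 Fgd]|infg] := pselect (exists2 d, 0 < d & F (g ^+ d)).
  exact: trivial_on_cover (cyclic_finite_cover nFK hK Kg cyc d0 Fgd) nP.
exists (maxn n m) => x [Dx Kx]; apply: nP; split.
  by apply: chain_leq Dx; rewrite leq_maxl.
suff posx z k : D m z -> eqmod F (g ^+ k) z -> F z.
  have Dmx : D m x by apply: chain_leq Dx; rewrite leq_maxr.
  have [k [xk|xk]] := cyc x Kx; first exact: posx xk.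
  apply: (subgroupVr hF); apply: posx xk.
  by apply: subgroupV => //; exact: chain_subgroup.
move=> /torD[d d0 zd] zk; case: k zk => [|k] zk.
  by move: zk; rewrite /eqmod invg1 mul1g.
case: infg; exists (k.+1 * d)%N; first by rewrite muln_gt0.
have [_ _ nF] := nFK; have := eqmodX hF hK nF d (subgroupX k.+1 hK Kg) zk.
rewrite zd -expgnA => /(eqmod_sym hF).
by rewrite /eqmod invg1 mul1g.
Qed.

End DescendingChains.

(** * Finite quotients *)

Section FiniteQuotient.
Variable G : groupType.
Implicit Types (x y z g : G) (U V K : set G) (p n m j : nat).

Lemma left_coset_eqP U x y : subgroup U ->
  left_coset x U = left_coset y U <-> eqmod U x y.
Proof.
move=> hU; have leftP u v : left_coset u U v <-> eqmod U u v.
  split=> [[w Uw <-]|uv]; first by rewrite /eqmod mulKg.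
  by exists (u^-1 * v); rewrite ?mulVKg.
split=> [E|xy]; first by apply/leftP; rewrite E; apply/leftP; exact: eqmod_refl.
apply/seteqP; split=> z /leftP zz; apply/leftP; apply: (eqmod_trans hU _ zz) => //.
exact: eqmod_sym.
Qed.

Section QuotientGroup.
Variables (U : set G) (T : finType) (c : G -> T) (r : T -> G).
Hypotheses (nU : normal_subgroup U setT) (rK : cancel r c).
Hypothesis cE : forall x y, c x = c y <-> eqmod U x y.

Let hU : subgroup U. Proof. by case: nU. Qed.
Let nUT : normalised U setT. Proof. by case: nU. Qed.

Let rc x : eqmod U (r (c x)) x. Proof. by apply/cE; rewrite rK. Qed.

Let qmul (a b : T) := c (r a * r b).
Let qinv (a : T) := c (r a)^-1.

Let cM x y : qmul (c x) (c y) = c (x * y).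
Proof. by apply/cE; apply: (eqmodM hU nUT). Qed.

Let qmulA : associative qmul.
Proof.
move=> a b d; rewrite -[a]rK -[b]rK -[d]rK.
by rewrite (cM (r b)) !cM mulgA.
Qed.

Let qmul1 : left_id (c 1) qmul.
Proof. by move=> a; rewrite -[a]rK cM mul1g. Qed.

Let qmulV : left_inverse (c 1) qinv qmul.
Proof. by move=> a; rewrite /qinv -[a in X in qmul _ X]rK cM mulVg. Qed.

(** An alias of [T] that carries the group law of [G / U], transported through the coding [c] and
    the representatives [r]. *)
Definition quotient_sort : Type := T.
HB.instance Definition _ := Finite.copy quotient_sort T.
HB.instance Definition _ :=
  Finite_isGroup.Build quotient_sort qmulA qmul1 qmulV.

Lemma quotient_finGroup : exists (gT : finGroupType) (f : G -> gT),
  [/\ {morph f : x y / x * y}, forall x, f x = 1 <-> U x,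
      forall q, exists x, f x = q & #|gT| = #|T|].
Proof.
exists quotient_sort, c; split=> [x y|x|q|].
- by rewrite -cM.
- have cU := cE 1 x; rewrite /eqmod invg1 mul1g in cU.
  by split=> [/esym/cU|/cU/esym].
- by exists (r q); rewrite rK.
- by apply: (@bij_eq_card _ _ (id : quotient_sort -> T)); exists id.
Qed.

End QuotientGroup.

(** Makes the theory of finite groups, such as the Cauchy theorem and the nilpotency of p-groups,
    available for finite quotients of [G]. *)
Lemma finite_quotient_finGroup U n : normal_subgroup U setT ->
    quotient setT U #= `I_n ->
  exists (gT : finGroupType) (f : G -> gT),
  [/\ {morph f : x y / x * y}, forall x, f x = 1 <-> U x,
      forall q, exists x, f x = q & #|gT| = n].
Proof.
move=> nU /card_set_bijP[b [bI bi bs]]; have [hU _ _] := nU.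
have bn x : b (left_coset x U) < n by apply: bI; exists x.
pose c x : 'I_n := Ordinal (bn x).
have /choice[r rP] : forall i : 'I_n, exists x, c x = i.
  move=> i; have [|_ [x _ <-] xi] := bs i; first exact: ltn_ord.
  by exists x; apply: val_inj.
have cE x y : c x = c y <-> eqmod U x y.
  split=> [[bxy]|/(left_coset_eqP _ _ hU) xy]; last by apply: val_inj; rewrite /= xy.
  by apply/(left_coset_eqP _ _ hU); apply: (bi _ _ _ _ bxy);
    rewrite inE; [exists x | exists y].
have [gT [f [fM fU fs cT]]] := quotient_finGroup nU rP cE.
by exists gT, f; split=> //; rewrite cT card_ord.
Qed.

End FiniteQuotient.

(** * Normal subgroups of p-power index *)

Section PQuotients.
Implicit Types (G H : groupType) (p n m j : nat).

(** A map with finitely many values that separates cosets passes to intersections by pairing and to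
    preimages by composition, with no new choice of representatives. *)
Lemma finite_coverP G (K U : set G) : subgroup U ->
  finite_cover K U <-> exists (T : eqType) (q : G -> T) (t : seq T),
    (forall x, K x -> q x \in t) /\
    (forall x y, K x -> K y -> q x = q y -> eqmod U x y).
Proof.
move=> hU; split=> [[s sP]|[T [q [t [qt qU]]]]].
  have /choice[q qP] : forall x, exists y, K x -> y \in s /\ eqmod U y x.
    move=> x; have [/sP[y ys yx]|nKx] := pselect (K x); first by exists y.
    by exists 1.
  exists G, q, s; split=> [x /qP[]//|x y /qP[_ xq] /qP[_ yq] E].
  by apply: (eqmod_trans hU _ yq); rewrite -E; apply: eqmod_sym.
exists [seq xget 1 [set x | K x /\ q x = i] | i <- t] => x Kx.
exists (xget 1 [set y | K y /\ q y = q x]).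
  by apply: (map_f (fun i => xget 1 [set y | K y /\ q y = i])); apply: qt.
have /(xgetPex 1)[Ky yx] : exists y, [set y | K y /\ q y = q x] y by exists x.
exact: qU.
Qed.

Lemma finite_cover_finite_quotient G (U : set G) : subgroup U ->
  finite_cover setT U -> finite_set (quotient setT U).
Proof.
move=> hU [s sP].
apply: (@sub_finite_set _ _ [set left_coset y U | y in [set` s]]).
  move=> _ [x _ <-]; have [y ys yx] := sP x I.
  by exists y => //; apply/(left_coset_eqP _ _ hU).
exact/finite_image/finite_seq.
Qed.

Lemma morph_1 G H (f : G -> H) : {morph f : x y / x * y} -> f 1 = 1.
Proof. by move=> fM; apply: (mulgI (f 1)); rewrite -fM !mulg1. Qed.

Lemma morph_V G H (f : G -> H) :
  {morph f : x y / x * y} -> {morph f : x / x^-1}.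
Proof.
by move=> fM x; apply: (mulgI (f x)); rewrite -fM !mulgV (morph_1 fM).
Qed.

Lemma morph_X G H (f : G -> H) n :
  {morph f : x y / x * y} -> {morph f : x / x ^+ n}.
Proof.
move=> fM x; elim: n => [|n IH]; first by rewrite !expg0 morph_1.
by rewrite !expgS fM IH.
Qed.

Lemma subgroup_preimage G H (f : H -> G) (U : set G) :
  {morph f : x y / x * y} -> subgroup U -> subgroup (f @^-1` U).
Proof.
move=> fM hU; apply/subgroupP; split=> [|x y|x] /=.
- by rewrite morph_1 //; apply: subgroup1.
- by rewrite fM; apply: subgroupM.
- by rewrite morph_V //; apply: subgroupV.
Qed.

(** Lagrange in one direction. In the other, the Cauchy theorem gives an element of order [q] for
    each prime [q] dividing the index, and a power of [p] kills it, so [q] is [p]. *)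
Lemma finite_p_quotientP G p (U : set G) : prime p -> normal_subgroup U setT ->
  finite_p_quotient p setT U <->
  finite_cover setT U /\ forall x, exists j, U (x ^+ (p ^ j)).
Proof.
move=> pp nU; have [hU _ _] := nU; split=> [[k qk]|[cU tU]].
  split; first by apply: finite_quotient_cover => //; exists (p ^ k)%N.
  have [gT [f [fM fU _ cT]]] := finite_quotient_finGroup nU qk.
  move=> x; exists k; apply/fU; rewrite (morph_X _ fM) -cT -cardsT.
  by apply: expg_cardG; rewrite inE.
have [n qn] := finite_cover_finite_quotient hU cU.
have [gT [f [fM fU fs cT]]] := finite_quotient_finGroup nU qn.
have : p.-group [set: gT]%SET.
  apply/pgroupP => q qp /(Cauchy qp)[a _ oa].
  have [x fx] := fs a; have [j /fU] := tU x.
  rewrite (morph_X _ fM) fx => /eqP; rewrite -order_dvdn oa.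
  by rewrite Euclid_dvdX // dvdn_prime2 // => /andP[].
by case/p_natP=> // k; rewrite cardsT cT => nE; exists k; rewrite -nE.
Qed.

Lemma lower_central_finite_p_quotient G p (U : set G) : prime p ->
    normal_subgroup U setT -> finite_p_quotient p setT U ->
  exists m, @lower_central G m `<=` U.
Proof.
move=> pp nU [k qk].
have [gT [f [fM fU _ cT]]] := finite_quotient_finGroup nU qk.
have /pgroup_nil/lcnP[m Lm] : p.-group [set: gT]%SET.
  by rewrite /pgroup cardsT cT pnatX pnat_id.
(* The index shifts by one: the series of a finite group starts at ['L_1], while [lower_central]
   starts at 0. *)
exists m; suff lcf n x : lower_central n x -> f x \in 'L_n.+1([set: gT]%SET).
  by move=> x /lcf; rewrite Lm => /set1P/fU.
elim: n x => [|n IH] x; first by rewrite inE.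
suff sub : @lower_central G n.+1 `<=` [set y | f y \in 'L_n.+2([set: gT]%SET)].
  exact: sub.
apply: smallest_sub => [|_ [y [z [/IH yL ->]]]].
  apply/subgroupP; split=> [|y z|y] /=; first by rewrite morph_1.
  - by move=> yL zL; rewrite fM groupM.
  - by rewrite morph_V // groupV.
have fR : f [~ y, z] = [~ f y, f z] by rewrite !fM !morph_V.
by rewrite /= fR lcnSn mem_commg // inE.
Qed.

Lemma finite_p_quotientI G p (U V : set G) : prime p ->
    normal_subgroup U setT -> normal_subgroup V setT ->
    finite_p_quotient p setT U -> finite_p_quotient p setT V ->
  normal_subgroup (U `&` V) setT /\ finite_p_quotient p setT (U `&` V).
Proof.
move=> pp nU nV; have [hU _ jU] := nU; have [hV _ jV] := nV.
have hUV := subgroupI hU hV.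
have nUV : normal_subgroup (U `&` V) setT.
  by split=> // x g [Ux Vx] _; split; [apply: jU | apply: jV].
move=> /(finite_p_quotientP pp nU)[cU tU] /(finite_p_quotientP pp nV)[cV tV].
split=> //; apply/(finite_p_quotientP pp nUV); split.
  have /(finite_coverP _ hU)[S [a [s [as' aU]]]] := cU.
  have /(finite_coverP _ hV)[T [b [t [bt bV]]]] := cV.
  apply/(finite_coverP _ hUV); exists (S * T)%type, (fun x => (a x, b x)).
  exists [seq (u, v) | u <- s, v <- t]; split=> [x _|x y _ _ [axy bxy]].
    by apply: allpairs_f; [apply: as' | apply: bt].
  by split; [apply: aU | apply: bV].
move=> x; have [i Ui] := tU x; have [j Vj] := tV x; exists (i + j)%N.
split; first by rewrite expnD expgnA; apply: subgroupX.
by rewrite addnC expnD expgnA; apply: subgroupX.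
Qed.

Lemma finite_p_quotient_preimage G H p (f : H -> G) (U : set G) : prime p ->
    {morph f : x y / x * y} -> normal_subgroup U setT ->
    finite_p_quotient p setT U ->
  normal_subgroup (f @^-1` U) setT /\ finite_p_quotient p setT (f @^-1` U).
Proof.
move=> pp fM nU; have [hU _ jU] := nU.
have hf := subgroup_preimage fM hU.
have nf : normal_subgroup (f @^-1` U) setT.
  split=> // x g /= Ux _; have -> : f (x ^ g) = f x ^ f g by rewrite !fM morph_V.
  exact: jU.
move=> /(finite_p_quotientP pp nU)[cU tU].
split=> //; apply/(finite_p_quotientP pp nf); split.
  have /(finite_coverP _ hU)[S [a [s [as' aU]]]] := cU.
  apply/(finite_coverP _ hf); exists S, (a \o f), s; split=> [x _|x y _ _ axy].
    exact: as'.
  by rewrite /eqmod /preimage /= fM morph_V //; apply: aU.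
by move=> x; have [j Uj] := tU (f x); exists j; rewrite /preimage /= morph_X.
Qed.

End PQuotients.

(** * The pro-p topology *)

Section ProPTopology.
Implicit Types (G : groupType) (p : nat).

Lemma finite_p_quotientT G p : prime p ->
  normal_subgroup (@setT G) setT /\ finite_p_quotient p (@setT G) setT.
Proof.
move=> pp; have nT : normal_subgroup (@setT G) setT.
  by split=> //; exact: subgroupT.
split=> //; apply/(finite_p_quotientP pp nT); split; last by exists 0.
by exists [:: 1] => x _; exists 1; rewrite ?mem_head.
Qed.

(** An intersection of finitely many subbasic cosets through [x] contains the coset of [x] modulo
    the intersection of their subgroups, which again has p-power index. *)
Lemma pro_p_openP G p (A : set (pro_p p G)) : prime p ->
  open A <-> forall x, A x -> exists U : set G,
    [/\ normal_subgroup U setT, finite_p_quotient p setT U &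
        left_coset (x : G) U `<=` A].
Proof.
move=> pp; split=> [[D' D'sub <-] x [B D'B Bx]|locA].
  have [E Esub EB] := D'sub _ D'B.
  suff [U [nU qU xU]] : exists U : set G,
    [/\ normal_subgroup U setT, finite_p_quotient p setT U &
        left_coset (x : G) U `<=` B].
    by exists U; split=> // y /xU By; exists B.
  have Ex (C : set G) : C \in enum_fset E -> C x.
    by move: Bx; rewrite -EB => Bx; apply: Bx.
  have {}Esub (C : set G) : C \in enum_fset E -> p_cosets p C.
    by move=> /Esub /set_mem.
  suff [U [nU qU xU]] : exists U : set G,
    [/\ normal_subgroup U setT, finite_p_quotient p setT U &
        forall C : set G, C \in enum_fset E -> left_coset (x : G) U `<=` C].
    exists U; split=> // y Uy; rewrite -EB => C CE; exact: (xU C CE).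
  elim: (enum_fset E) Ex Esub => [|C s IH] sx sC.
    by exists setT; have [? ?] := finite_p_quotientT G pp.
  have [C' C's|C' C's|U [nU qU xU]] := IH.
  - by apply: sx; rewrite inE C's orbT.
  - by apply: sC; rewrite inE C's orbT.
  have [V [g [nV qV CE]]] := sC C (mem_head _ _).
  have [nUV qUV] := finite_p_quotientI pp nU nV qU qV.
  exists (U `&` V); split=> // C'; rewrite inE => /orP[/eqP->|C's].
    have : C x by apply: sx; rewrite mem_head.
    rewrite CE => -[v Vv <-] _ [w [_ Vw] <-].
    exists (v * w); last by rewrite mulgA.
    by have [hV _ _] := nV; apply: subgroupM.
  by apply: subset_trans (xU _ C's) => _ [w [Uw _] <-]; exists w.
have -> : A = \bigcup_(B in [set B | p_cosets p B /\ B `<=` A]) B.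
  apply/seteqP; split=> [x Ax|x [B [_ BA] /BA //]].
  have [U [nU qU xU]] := locA x Ax.
  exists (left_coset (x : G) U); first by split=> //; exists U, x.
  by exists 1; rewrite ?mulg1 //; apply: subgroup1; case: nU.
apply: bigcup_open => B [pB _]; exists [set B]; last by rewrite bigcup_set1.
move=> _ ->; exists [fset (B : set G)]%fset.
  by move=> C /fset1P ->; apply/mem_set.
by rewrite set_fset1 bigcap_set1.
Qed.

(** Both topologies are invariant under translation and the subspace topology is always the coarser
    one, so only neighbourhoods of 1 in [H] have to be compared. *)
Lemma induces_full_pro_pP G p (S : {pred G}) (H : subGroupType S) : prime p ->
  induces_full_pro_p p H <->
  forall N : set H, normal_subgroup N setT -> finite_p_quotient p setT N ->
    exists U : set G, [/\ normal_subgroup U setT, finite_p_quotient p setT U &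
      forall h, U (val h) -> N h].
Proof.
move=> pp; have valM : {morph (val : H -> G) : x y / x * y}.
  by move=> x y; rewrite gmulfM.
split=> [ind N nN qN|ind].
  have hN : subgroup N by case: nN.
  have : @open (pro_p p H) N.
    apply/(pro_p_openP _ pp) => x Nx; exists N; split=> // _ [y Ny <-].
    exact: subgroupM.
  rewrite -ind => -[W oW WN].
  have W1 : W (val (1 : H)) by have : N 1 by [apply: subgroup1]; rewrite -WN.
  have [U [nU qU UW]] := (pro_p_openP W pp).1 oW _ W1.
  exists U; split=> // h Uh; rewrite -WN; apply: UW.
  by exists (val h) => //; rewrite (morph_1 valM) mul1g.
apply/seteqP; split=> [_ [W oW <-]|A oA].
  apply/(pro_p_openP _ pp) => x Wx.
  have [U [nU qU UW]] := (pro_p_openP W pp).1 oW _ Wx.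
  have [nV qV] := finite_p_quotient_preimage pp valM nU qU.
  exists ((val : H -> G) @^-1` U); split=> // _ [h Uh <-]; apply: UW.
  by exists (val h) => //; rewrite valM.
(* The open set of [G] that traces [A] is the union of all cosets of elements of [H] whose trace on
   [H] lies in [A]. *)
exists [set g : G | exists U h, [/\ normal_subgroup U setT,
    finite_p_quotient p setT U, left_coset (val (h : H)) U g &
    (val : H -> G) @^-1` (left_coset (val (h : H)) U) `<=` A]].
  apply/(pro_p_openP _ pp) => g [U [h [nU qU hUg hUA]]].
  exists U; split=> // _ [u Uu <-]; exists U, h; split=> //.
  case: hUg => w Uw <-; exists (w * u); last by rewrite mulgA.
  by apply: subgroupM => //; case: nU.
apply/seteqP; split=> [x [U [h [nU qU hUg hUA]]]|x Ax]; first exact: hUA.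
have [N [nN qN NA]] := (pro_p_openP A pp).1 oA _ Ax.
have [U [nU qU UN]] := ind _ nN qN.
exists U, x; split=> //.
  by exists 1; rewrite ?mulg1 //; apply: subgroup1; case: nU.
move=> y [u Uu xuy]; apply: NA; exists (x^-1 * y); last by rewrite mulVKg.
by apply: UN; rewrite valM (morph_V valM) -xuy mulKg.
Qed.

End ProPTopology.

(** * Nilpotent groups induce the full pro-p topology *)

Section UpperCentral.
Variable G : groupType.
Implicit Types (x y z g h c : G) (U V Z H N : set G) (m n i j : nat).

(** For normal [Z], the preimage in [G] of the centre of [G / Z]. *)
Definition center_mod Z : set G := [set x | forall g, Z [~ x, g]].

(* [~ x, g] is [x^-1 * x ^ g], so [Z [~ x, g]] and [eqmod Z x (x ^ g)] are
   convertible. *)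
Lemma center_modE Z x : center_mod Z x = forall g, eqmod Z x (x ^ g).
Proof. by []. Qed.

Lemma center_mod_normal Z : normal_subgroup Z setT ->
  normal_subgroup (center_mod Z) setT.
Proof.
move=> [hZ _ nZ]; split=> [|//|x k cx _ g]; last first.
  rewrite -[g](conjgKV k) -conjRg; exact: nZ.
apply/subgroupP; split=> [g|x y cx cy|x cx].
- by rewrite comm1g; apply: subgroup1.
- rewrite center_modE => g; rewrite conjMg.
  by apply: (eqmodM hZ nZ) => //; [apply: cx | apply: cy].
- rewrite center_modE => g; rewrite conjVg.
  by apply: (eqmodV hZ (subgroupT G) nZ) => //; apply: cx.
Qed.

Lemma sub_center_mod Z : normal_subgroup Z setT -> Z `<=` center_mod Z.
Proof.
by move=> [hZ _ nZ] x Zx g; apply: subgroupM => //; [apply: subgroupV|apply: nZ].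
Qed.

Fixpoint upper_central_mod U n :=
  if n is m.+1 then center_mod (upper_central_mod U m) else U.

Lemma upper_central_mod_normal U n : normal_subgroup U setT ->
  normal_subgroup (upper_central_mod U n) setT.
Proof. by move=> nU; elim: n => //= n; apply: center_mod_normal. Qed.

Lemma sub_upper_central_mod U n : normal_subgroup U setT ->
  U `<=` upper_central_mod U n.
Proof.
move=> nU; elim: n => //= n IH x /IH; apply: sub_center_mod.
exact: upper_central_mod_normal.
Qed.

Lemma commg_lower_central n x g :
  lower_central n x -> lower_central n.+1 [~ x, g].
Proof. by move=> Lx; apply: sub_gen_smallest; exists x, g. Qed.

Lemma nilpotent_upper_central_mod U : normal_subgroup U setT -> nilpotent G ->
  exists n, upper_central_mod U n = setT.
Proof.
move=> nU [n Ln]; exists n; apply/seteqP; split=> // x _.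
suff sub i : i <= n -> @lower_central G (n - i) `<=` upper_central_mod U i.
  by apply: (sub n) => //; rewrite subnn.
elim: i => [|i IH] lein /=.
  by rewrite subn0 Ln => _ ->; apply: subgroup1; case: nU.
move=> y Ly g; apply: IH; first exact: ltnW.
by rewrite -subnSK //; apply: commg_lower_central.
Qed.

(** Bezout with natural coefficients, [u * m = v * n + 1]; this form requires [m] positive, hence
    the separate case of 0. *)
Lemma subgroup_coprime N h m n : subgroup N -> coprime m n ->
  N (h ^+ m) -> N (h ^+ n) -> N h.
Proof.
move=> hN; case: m => [|m] cmn Nm Nn.
  by move: cmn Nn; rewrite /coprime gcd0n => /eqP->.
have [u v E _] := egcdnP n (ltn0Sn m).
move: E; rewrite (eqP cmn) => E.
have : N (h ^+ (u * m.+1)) by rewrite mulnC expgnA; apply: subgroupX.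
rewrite E expgnDr expg1; apply: subgroupMl => //.
by rewrite mulnC expgnA; apply: subgroupX.
Qed.

(* The subgroup generated by [U] and [c], for [c] central modulo [U]; the two
   exponents avoid negative powers. *)
Definition adjoin U c : set G :=
  [set x | exists a b, eqmod U (c ^+ a) (c ^+ b * x)].

Lemma adjoin_normal U c : normal_subgroup U setT -> center_mod U c ->
  normal_subgroup (adjoin U c) setT.
Proof.
move=> nU cc; have [hU _ jU] := nU;
have ccX n : center_mod U (c ^+ n).
  by apply: subgroupX cc; case: (center_mod_normal nU).
split=> [|//|x g [a [b E]] _]; last first.
  exists a, b; apply: (@eqmod_trans _ _ hU (c ^+ a ^ g)); first exact: ccX.
  apply: (@eqmod_trans _ _ hU ((c ^+ b * x) ^ g)).
    by have := jU _ g E I; rewrite /eqmod conjMg conjVg.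
  rewrite conjMg; apply: (eqmodM hU jU) => //; last exact: eqmod_refl.
  by apply: eqmod_sym => //; apply: ccX.
apply/subgroupP; split=> [|x y [a [b E]] [a' [b' E']]|x [a [b E]]].
- by exists 0, 0; rewrite mulg1; apply: eqmod_refl.
- exists (a + a')%N, (b + b')%N; rewrite !expgnDr.
  apply: (@eqmod_trans _ _ hU (c ^+ b * x * (c ^+ b' * y))); first exact: (eqmodM hU jU).
  have -> : c ^+ b * x * (c ^+ b' * y) = c ^+ b * (x * c ^+ b') * y.
    by rewrite !mulgA.
  have -> : c ^+ b * c ^+ b' * (x * y) = c ^+ b * (c ^+ b' * x) * y.
    by rewrite !mulgA.
  apply: (eqmodM hU jU) => //; last exact: eqmod_refl.
  apply: (eqmodM hU jU) => //; first exact: eqmod_refl.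
  rewrite conjgCV; apply: (eqmodM hU jU) => //; last exact: eqmod_refl.
  by apply: eqmod_sym => //; apply: ccX.
- exists b, a; apply: (@eqmod_trans _ _ hU (c ^+ b * x * x^-1)).
    by rewrite mulgK; apply: eqmod_refl.
  by apply: (eqmodM hU jU) => //; [apply: eqmod_sym | apply: eqmod_refl].
Qed.

End UpperCentral.

(** * Normal subgroups of [G] whose trace on [H] lies in [N] *)

Section Separation.
Variables (G : groupType) (p : nat) (H N : set G).
Hypotheses (pp : prime p) (hH : subgroup H) (hN : subgroup N) (sNH : N `<=` H).
Hypothesis pHN : forall h, H h -> exists j, N (h ^+ (p ^ j)).
Implicit Types (x y z g h c : G) (U V Z : set G) (m n i j : nat).

Let separates U := normal_subgroup U setT /\ U `&` H `<=` N.

Lemma maximal_separating : exists U, separates U /\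
  forall V, separates V -> U `<=` V -> V `<=` U.
Proof.
pose P U := U = set0 \/ separates U.
have [|U [PU maxU]] := @Zorn_bigcup _ P.
  move=> F FP totF; have [[X [FX sX]]|noX] := pselect (exists X, F X /\ separates X).
    right; have sepF Y y : F Y -> Y y -> separates Y.
      by move=> /FP[->|].
    have [[hX _ _] _] := sX; split; last first.
      move=> x [[Y FY Yx] Hx]; have [_] := sepF _ _ FY Yx; exact.
    split=> // [|x g [Y FY Yx] _]; last first.
      by have [[_ _ jY] _] := sepF _ _ FY Yx; exists Y => //; apply: jY.
    apply/subgroupP; split=> [|x y [Y FY Yx] [Z FZ Zy]|x [Y FY Yx]].
    - by exists X => //; apply: subgroup1.
    - have [[hY _ _] _] := sepF _ _ FY Yx; have [[hZ _ _] _] := sepF _ _ FZ Zy.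
      have [YZ|ZY] := totF _ _ FY FZ.
        by exists Z => //; apply: subgroupM => //; apply: YZ.
      by exists Y => //; apply: subgroupM => //; apply: ZY.
    - have [[hY _ _] _] := sepF _ _ FY Yx.
      by exists Y => //; apply: subgroupV.
  left; apply/seteqP; split=> // x [X FX Xx].
  have [X0|sX] := FP _ FX; first by rewrite X0 in Xx.
  by case: noX; exists X.
have max V : separates V -> U `<=` V -> V `<=` U.
  move=> sV UV; apply: contrapT => VU.
  by apply: (maxU V); [split | right].
case: PU => [U0|sU]; last by exists U.
have s1 : separates [set 1].
  split; last by move=> _ [-> _]; apply: subgroup1.
  split=> // [|_ g -> _]; last by rewrite conj1g.
  apply/subgroupP; split=> // [_ _ -> ->|_ ->]; first by rewrite mulg1.
  by rewrite invg1.
have : U 1 by apply: (max _ s1) => //; rewrite U0.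
by rewrite U0.
Qed.

Section MaximalSeparating.
Variable U : set G.
Hypotheses (nU : normal_subgroup U setT) (UHN : U `&` H `<=` N).
Hypothesis maxU : forall V, separates V -> U `<=` V -> V `<=` U.

Let hU : subgroup U. Proof. by case: nU. Qed.
Let jU : normalised U setT. Proof. by case: nU. Qed.

(** Otherwise [adjoin U c], which contains [U] and [c], would separate, against the maximality of
    [U]. *)
Lemma adjoin_escapes c : center_mod U c -> ~ U c ->
  exists h, [/\ H h, ~ N h & adjoin U c h].
Proof.
move=> cc Uc; apply: contrapT => noh; apply: Uc.
apply: (@maxU (adjoin U c)).
- split; first exact: adjoin_normal.
  move=> h [ch Hh]; apply: contrapT => Nh; apply: noh.
  by exists h.
- by move=> u Uu; exists 0, 0; rewrite /eqmod invg1 !mul1g.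
- by exists 1%N, 0; rewrite mul1g; apply: eqmod_refl.
Qed.

Lemma center_modX c n : center_mod U c -> center_mod U (c ^+ n).
Proof. by apply: subgroupX; case: (center_mod_normal nU). Qed.

Lemma eqmod_adjoinX c a b h n : center_mod U c ->
  eqmod U (c ^+ a) (c ^+ b * h) ->
  eqmod U (c ^+ (a * n)) (c ^+ (b * n) * h ^+ n).
Proof.
move=> cc E; rewrite !expgnA.
apply: (@eqmod_trans _ _ hU ((c ^+ b * h) ^+ n)).
  exact: (eqmodX hU (subgroupT G) jU).
apply: (eqmod_expMn hU (subgroupT G) jU) => //.
exact: center_modX.
Qed.

(* Otherwise some [c ^+ m] with [m > 0] agrees modulo [U] with an element of
   [N]; then [adjoin U (c ^+ m)] meets [H] inside [N], against maximality. *)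
Lemma center_mod_torsion c : center_mod U c -> exists2 d, 0 < d & U (c ^+ d).
Proof.
move=> cc; apply: contrapT => ntor.
have Uc d : 0 < d -> ~ U (c ^+ d) by move=> d0 Ud; apply: ntor; exists d.
have [h [Hh Nh [a [b E]]]] := adjoin_escapes cc (Uc 1%N isT).
have [j Nhj] := pHN Hh; have E' := eqmod_adjoinX (p ^ j) cc E.
(* Modulo [U], [h] is [c] to the power [a - b]. Raising to the power [p ^ j] brings [h] into [N], so
   [m] is the distance of [a] and [b] times [p ^ j]; if [a = b], then [h] is in [U] and hence in
   [N]. *)
have [m [z [m0 Nz zm]]] : exists m z, [/\ 0 < m, N z & eqmod U (c ^+ m) z].
  have q0 : 0 < p ^ j by rewrite expn_gt0 prime_gt0.
  have [ab|ba|ab] := ltngtP a b.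
  - exists ((b - a) * p ^ j)%N, (h ^- (p ^ j)).
    split; [by rewrite muln_gt0 subn_gt0 ab | exact: subgroupV |].
    move: E'; rewrite -[in (b * _)%N](subnKC (ltnW ab)) mulnDl expgnDr.
    rewrite /eqmod -!mulgA mulKg => E'.
    have := subgroupV hU (jU (g := h ^- (p ^ j)) E' I).
    by rewrite conjgE invgK !mulgA mulgK invgM.
  - exists ((a - b) * p ^ j)%N, (h ^+ (p ^ j)).
    split=> //; first by rewrite muln_gt0 subn_gt0 ba.
    move: E'; rewrite -[in (a * _)%N](subnKC (ltnW ba)) mulnDl expgnDr.
    by rewrite /eqmod invgM -!mulgA mulKg.
  - case: Nh; apply: UHN; split=> //.
    by move: E; rewrite ab /eqmod mulKg.
have [h' [Hh' Nh' [a' [b' F]]]] := adjoin_escapes (center_modX m cc) (Uc m m0).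
have T n : eqmod U (c ^+ m ^+ n) (z ^+ n).
  exact: (eqmodX hU (subgroupT G) jU).
case: Nh'; apply: (subgroupMl hN (subgroupX b' hN Nz)).
suff UU : eqmod U (z ^+ a') (z ^+ b' * h').
  apply: (@subgroupMl _ _ (z ^- a')) => //; first exact/(subgroupV hN)/(subgroupX _ hN).
  apply: UHN; split=> //; apply: (subgroupM hH).
    exact/(subgroupV hH)/(subgroupX _ hH)/sNH.
  by apply: (subgroupM hH) => //; apply/(subgroupX _ hH)/sNH.
apply: (@eqmod_trans _ _ hU (c ^+ m ^+ a')); first exact: eqmod_sym.
apply: (eqmod_trans hU F); apply: (eqmodM hU jU) => //; exact: eqmod_refl.
Qed.

(** Let [s] be the part of [d] prime to [p]. If the p-part of [d] did not kill [c] modulo [U], the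
    escaping [h] would satisfy [h ^+ s] in [U], hence in [N]; with [h ^+ (p ^ j)] in [N], this puts
    [h] in [N]. *)
Lemma center_mod_p_torsion c : center_mod U c -> exists j, U (c ^+ (p ^ j)).
Proof.
move=> cc; have [d d0 Ud] := center_mod_torsion cc.
have [s ps dE] := pfactor_coprime pp d0.
exists (logn p d); apply: contrapT => Uc.
have [h [Hh Nh [a [b E]]]] := adjoin_escapes (center_modX _ cc) Uc.
have [j Nhj] := pHN Hh.
case: Nh; apply: (@subgroup_coprime _ _ _ s (p ^ j)) => //.
  by rewrite coprime_sym coprimeXl.
apply: UHN; split; last exact: subgroupX.
have := eqmod_adjoinX s (center_modX (p ^ logn p d) cc) E.
move/(eqmod_mem hU).
have Uq n : U (c ^+ (p ^ logn p d) ^+ (n * s)).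
  rewrite -expgnA mulnCA [(_ * s)%N]mulnC -dE mulnC expgnA.
  exact: subgroupX.
by move=> /(_ (Uq _)) /(subgroupMl hU (Uq _)).
Qed.

(** By induction, one power [q] of [p] kills modulo [U] the commutators of [x] with all generators.
    These are central modulo the term [Z] two steps down, so [[~ x ^+ q, g]] agrees with [[~ x, g]
    ^+ q] modulo [Z], and [x ^+ q] drops one step in the series. *)
Lemma upper_central_mod_p_torsion s n x : generated_by (@setT G) s ->
  upper_central_mod U n x -> exists j, U (x ^+ (p ^ j)).
Proof.
move=> gens; elim: n x => [|[|n] IH] x.
- by exists 0.
- exact: center_mod_p_torsion.
move=> Zx; have nZ := upper_central_mod_normal n nU.
pose Z := upper_central_mod U n; have [hZ _ jZ] := nZ.
have [j Uj] : exists j, forall y, y \in s -> U ([~ x, y] ^+ (p ^ j)).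
  elim: (s) => [|y t [j tj]]; first by exists 0.
  have [i Ui] := IH _ (Zx y); exists (i + j)%N => g.
  rewrite inE => /orP[/eqP->|/tj gt].
    by rewrite expnD expgnA; apply: subgroupX.
  by rewrite addnC expnD expgnA; apply: subgroupX.
have [|i Ui] := IH (x ^+ (p ^ j)); last first.
  by exists (j + i)%N; rewrite expnD expgnA.
set y := x ^+ _.
(* The elements centralising [y] modulo [Z] form a subgroup, so generators suffice. *)
suff sub : [set: G] `<=` [set g | eqmod Z y (y ^ g)] by move=> g; apply: sub.
apply: gens => [|g gs].
  apply/subgroupP; split=> /= [|g k Zg Zk|g Zg].
  - by rewrite conjg1; apply: eqmod_refl.
  - apply: (eqmod_trans hZ Zk); rewrite conjgM.
    by have := jZ _ k Zg I; rewrite /eqmod conjMg conjVg.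
  - apply: (eqmod_sym hZ).
    by have := jZ _ g^-1 Zg I; rewrite /eqmod conjMg conjVg conjgK.
apply: (@eqmod_trans _ _ hZ (y * [~ x, g] ^+ (p ^ j))).
  by rewrite /eqmod mulKg; apply: sub_upper_central_mod (Uj _ gs).
rewrite conjXg; have -> : x ^ g = x * [~ x, g] by rewrite commgEl mulVKg.
apply: (eqmod_sym hZ); apply: (eqmod_expMn hZ (subgroupT G) jZ) => //.
by rewrite -invgR; apply: subgroupV => //; apply: (Zx g x).
Qed.

End MaximalSeparating.

Lemma nilpotent_separation : virtually_polycyclic G -> nilpotent G ->
  exists U, [/\ normal_subgroup U setT, finite_p_quotient p setT U &
    U `&` H `<=` N].
Proof.
move=> vpG nilG; have [U [[nU UHN] maxU]] := maximal_separating.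
have [s gens] := virtually_polycyclic_fg vpG.
have [n Zn] := nilpotent_upper_central_mod nU nilG.
have tU x : exists j, U (x ^+ (p ^ j)).
  by apply: (upper_central_mod_p_torsion nU UHN maxU gens (n := n)); rewrite Zn.
exists U; split=> //; apply/(finite_p_quotientP pp nU); split=> //.
apply: finite_cover_torsion => // x; have [j Uj] := tU x.
by exists (p ^ j)%N => //; rewrite expn_gt0 prime_gt0.
Qed.

End Separation.

(** * The converse *)

Section SubgroupType.
Variables (G : groupType) (K : set G).

(** The proof is an argument of the type so that the group instance can be inferred from the type
    alone. *)
Definition subgroup_type of subgroup K : Type := {x : G | x \in [in K]}.

Variable hK : subgroup K.
HB.instance Definition _ :=
  SubChoice.copy (subgroup_type hK) {x : G | x \in [in K]}.
HB.instance Definition _ :=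
  SubChoice_isSubGroup.Build G [in K] (subgroup_type hK) hK.

End SubgroupType.

(** * Detecting elements in finite p-quotients through cyclic subgroups *)

Section CyclicSubgroups.
Variable G : groupType.
Implicit Types (x y z g : G) (p a b d n : nat).

(* [cyclic_mod 1 x] is the subgroup generated by [x], and [cyclic_mod p x] the
   subgroup generated by [x ^+ p]. *)
Definition cyclic_mod p x : set G :=
  [set y | exists a b, a = b %[mod p] /\ y = x ^+ a / x ^+ b].

Lemma cyclic_mod_subgroup p x : subgroup (cyclic_mod p x).
Proof.
apply/subgroupP; split=> [|_ _ [a [b [ab ->]]] [c [d [cd ->]]]|_ [a [b [ab ->]]]].
- by exists 0, 0; rewrite divgg.
- exists (a + c)%N, (b + d)%N; split; first by rewrite -modnDm ab cd modnDm.
  have comm : commute (x ^+ b)^-1 (x ^+ c / x ^+ d).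
    apply: commuteM; apply/commute_sym/commuteV; last apply/commute_sym/commuteV.
      exact/commuteX2.
    exact/commuteX2.
  by rewrite -mulgA comm -mulgA -invgM -expgnDr mulgA -expgnDr.
- by exists b, a; rewrite invgF.
Qed.

(** The hypothesis covers at once an [x] of infinite order, where [d] is 0, and an [x] of finite
    order divisible by [p]. *)
Lemma order_eqn_mod p x a b : (forall d, x ^+ d = 1 -> p %| d) ->
  x ^+ a = x ^+ b -> a = b %[mod p].
Proof.
move=> ox; wlog ab : a b / a <= b.
  by move=> W; case/orP: (leq_total a b) => [/W//|/W + /esym xx] => /(_ xx).
move=> xab; apply/eqP; rewrite eq_sym eqn_mod_dvd //; apply: ox.
by rewrite expgnFr // xab divgg.
Qed.

(* The hypothesis is applied to the subgroup generated by [x] and its open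
   subgroup generated by [x ^+ p], which does not contain [x]. *)
Lemma induces_escape p x : prime p ->
    (forall (S : {pred G}) (H : subGroupType S), induces_full_pro_p p H) ->
    (forall d, x ^+ d = 1 -> p %| d) ->
  exists U, [/\ normal_subgroup U setT, finite_p_quotient p setT U & ~ U x].
Proof.
move=> pp ind ox; pose hC := cyclic_mod_subgroup 1 x.
pose H : subGroupType _ := subgroup_type hC.
have valM : {morph (val : H -> G) : u v / u * v} by move=> u v; rewrite gmulfM.
have HP (h : H) : cyclic_mod 1 x (val h) by have := valP h => /set_mem.
pose N := (val : H -> G) @^-1` cyclic_mod p x.
have hp := cyclic_mod_subgroup p x.
have nN : normal_subgroup N setT.
  split=> //; first exact: subgroup_preimage.
  move=> u g Nu _; suff -> : u ^ g = u by [].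
  apply/conjg_fixP/commgP; apply: val_inj; rewrite !valM.
  have [a [b [_ ->]]] := HP u; have [c [d [_ ->]]] := HP g.
  by apply: commuteM; apply/commute_sym; apply: commuteM;
    do ?[apply: commuteV | apply/commute_sym/commuteV]; apply: commuteX2.
have qN : finite_p_quotient p setT N.
  apply/(finite_p_quotientP pp nN); split.
    have hx : x \in [in cyclic_mod 1 x].
      by apply/mem_set; exists 1%N, 0; rewrite expg1 divg1 !modn1.
    pose xH : H := Sub x hx.
    have valX n : val (xH ^+ n) = x ^+ n by rewrite (morph_X _ valM) SubK.
    exists [seq xH ^+ i | i <- iota 0 p] => h _.
    (* Modulo [p] the factor [p.-1] is -1, so [r] is the residue of [a - b]. *)
    have [a [b [_ hE]]] := HP h; pose r := ((a + b * p.-1) %% p)%N.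
    exists (xH ^+ r); first by apply: map_f; rewrite mem_iota ltn_mod prime_gt0.
    exists a, (b + r)%N; split.
      rewrite modnDmr addnCA -mulnS prednK ?prime_gt0 //.
      by rewrite -[RHS]modnDmr modnMl addn0.
    rewrite valM (morph_V valM) valX hE expgnDr invgM !mulgA.
    by congr (_ / _); apply/commute_sym/commuteV/commuteX2.
  move=> h; have [a [b [_ hE]]] := HP h; exists 1%N.
  exists (a * p)%N, (b * p)%N; rewrite !modnMl; split=> //.
  rewrite (morph_X _ valM) hE expn1 expgnFl ?expgnA //; exact: commuteX2.
have [U [nU qU UN]] := (induces_full_pro_pP H pp).1 (ind _ H) N nN qN.
exists U; split=> // Ux.
have hx : x \in [in cyclic_mod 1 x].
  by apply/mem_set; exists 1%N, 0; rewrite expg1 divg1 !modn1.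
have [a [b [ab xE]]] := UN (Sub x hx : H) Ux; rewrite SubK in xE.
(* [x] would be a power of [x ^+ p], and comparing exponents modulo [p] gives that [p] divides 1. *)
have : b.+1 = b %[mod p].
  rewrite -ab; apply: (order_eqn_mod ox).
  by rewrite expgS [X in X * _]xE mulgVK.
move/eqP; rewrite eqn_mod_dvd // subSnn dvdn1 => /eqP p1.
by rewrite p1 in pp.
Qed.

End CyclicSubgroups.

(** * The lower central series *)

Section LowerCentral.
Variable G : groupType.
Implicit Types (x y z g : G) (U : set G) (e n p : nat).

Lemma subgroup_gen_subgroup (A : set G) : subgroup (subgroup_gen A).
Proof.
apply/subgroupP; split=> [B [hB _]|x y Ax Ay B [hB AB]|x Ax B [hB AB]].
- exact: subgroup1.
- by apply: subgroupM => //; [apply: Ax | apply: Ay].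
- by apply: subgroupV => //; apply: Ax.
Qed.

Lemma lower_central_ind n U : subgroup U ->
    (forall x g, lower_central n x -> U [~ x, g]) ->
  @lower_central G n.+1 `<=` U.
Proof.
by move=> hU UR; apply: smallest_sub => // _ [x [g [Lx ->]]]; apply: UR.
Qed.

Lemma lower_central_normal n : normal_subgroup (@lower_central G n) setT.
Proof.
elim: n => [|n IH].
  by split=> //; exact: subgroupT.
have hL : subgroup (@lower_central G n.+1) by exact: subgroup_gen_subgroup.
split=> // x g Lx _; have [_ _ nL] := IH.
suff : @lower_central G n.+1 `<=` [set y | lower_central n.+1 (y ^ g)] by apply.
apply: lower_central_ind => [|y k Ly].
  apply/subgroupP; split=> [|y z|y] /=.
  - by rewrite conj1g; apply: subgroup1.
  - by rewrite conjMg; apply: subgroupM.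
  - by rewrite conjVg; apply: subgroupV.
rewrite /= conjRg; apply: commg_lower_central; exact: nL.
Qed.

Lemma lower_centralS n : @lower_central G n.+1 `<=` lower_central n.
Proof.
have [hL _ nL] := lower_central_normal n; apply: lower_central_ind => // x g Lx.
by rewrite commgEl; apply: subgroupM => //; [apply: subgroupV | apply: nL].
Qed.

(* Commutation with [g] is a homomorphism from the [n]-th factor of the series
   to the next one. *)
Lemma lower_central_exponentS n e :
    (forall x, lower_central n x -> lower_central n.+1 (x ^+ e)) ->
  forall x, @lower_central G n.+1 x -> lower_central n.+2 (x ^+ e).
Proof.
move=> He; have [hL _ nL] := lower_central_normal n.+2.
have [hL1 _ nL1] := lower_central_normal n.+1.
have L2 x y : lower_central n.+1 x -> lower_central n.+2 [~ x, y].
  exact: commg_lower_central.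
have expM := eqmod_expMn hL (subgroupT G) nL.
suff : @lower_central G n.+1 `<=`
    lower_central n.+1 `&` [set x | lower_central n.+2 (x ^+ e)].
  by move=> sub x /sub[].
apply: lower_central_ind => [|x g Lx].
  apply/subgroupP; split=> [|x y [Lx Ex] [Ly Ey]|x [Lx Ex]].
  - by split; [|rewrite /= expg1n]; apply: subgroup1.
  - split; first exact: (subgroupM hL1).
    apply: (eqmod_mem hL _ (subgroupM hL Ex Ey)).
    by apply: (eqmod_sym hL); apply: expM => //; apply: L2.
  - split; first exact: (subgroupV hL1).
    by rewrite /= expVgn; apply: (subgroupV hL).
have LR : lower_central n.+1 [~ x, g] by apply: commg_lower_central.
split=> //=; have xe : eqmod (@lower_central G n.+2) (x ^+ e) ((x ^ g) ^+ e).
  by rewrite -conjXg; apply: (L2 _ g (He _ Lx)).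
have xg : x ^ g = x * [~ x, g] by rewrite commgEl mulVKg.
have : eqmod (@lower_central G n.+2) (x ^+ e) (x ^+ e * [~ x, g] ^+ e).
  apply: (eqmod_trans hL xe); rewrite xg; apply: expM => //.
  by rewrite -invgR; apply: (subgroupV hL); apply: L2.
by rewrite /eqmod mulKg.
Qed.

Section Induces.
Hypotheses (vpG : virtually_polycyclic G)
  (ind : forall (S : {pred G}) (H : subGroupType S) p,
     prime p -> induces_full_pro_p p H).

Lemma lower_central_escape p x : prime p -> (forall d, x ^+ d = 1 -> p %| d) ->
  exists n, ~ lower_central n x.
Proof.
move=> pp ox.
have [U [nU qU Ux]] := induces_escape pp (fun S H => ind H pp) ox.
have [n nU'] := lower_central_finite_p_quotient pp nU qU.
by exists n => /nU'.
Qed.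

(** For [x] of infinite order any prime will do, and 2 is taken. Otherwise a power [y] of [x] has
    prime order, and a term omitting [y] omits [x]. *)
Lemma lower_central_residual x : x != 1 -> exists n, ~ lower_central n x.
Proof.
move=> x1; have [tor|ntor] := pselect (exists d, (0 < d) && (x ^+ d == 1)); last first.
  apply: (@lower_central_escape 2) => // -[|d] xd //.
  by case: ntor; exists d.+1; rewrite xd eqxx.
case: (ex_minnP tor) => d /andP[d0 /eqP xd] dmin.
have d1 : 1 < d.
  by rewrite ltn_neqAle d0 andbT eq_sym; apply: contraNneq x1 => d1; rewrite -xd d1.
have pp := pdiv_prime d1; set p := pdiv d in pp.
have dE : d = (d %/ p * p)%N by rewrite divnK // pdiv_dvd.
have dp0 : 0 < d %/ p by rewrite divn_gt0 ?prime_gt0 // dvdn_leq // pdiv_dvd.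
pose y := x ^+ (d %/ p).
have yp : y ^+ p = 1 by rewrite -expgnA -dE.
have y1 : y <> 1.
  move=> /eqP yx; have := dmin (d %/ p); rewrite dp0 yx => /(_ isT).
  by rewrite leqNgt ltn_Pdiv // prime_gt1.
have [|n Ly] := @lower_central_escape p y pp.
  move=> k yk; apply/negPn/negP => pk; apply: y1.
  have s1 : subgroup [set (1 : G)].
    apply/subgroupP; split=> // [_ _ -> ->|_ ->]; first by rewrite mulg1.
    by rewrite invg1.
  by apply: (subgroup_coprime s1 _ yp yk); rewrite prime_coprime.
exists n => Lx; apply: Ly; apply: subgroupX => //.
by case: (lower_central_normal n).
Qed.

Lemma lower_central_torsion n e : 0 < e ->
    (forall x, lower_central n x -> lower_central n.+1 (x ^+ e)) ->
  forall x, @lower_central G n x -> exists2 d, 0 < d & x ^+ d = 1.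
Proof.
move=> e0 He x Lx; apply: contrapT => ntor.
(* A prime above [e] is prime to [e]. *)
have [p ep pp] := prime_above e.
have [d xd|U [nU qU Ux]] := induces_escape (x := x) pp (fun S H => ind H pp).
  by case: d xd => // d xd; case: ntor; exists d.+1.
have [m Lm] := lower_central_finite_p_quotient pp nU qU.
apply: Ux; have [hU _ _] := nU; have [_ tU] := (finite_p_quotientP pp nU).1 qU.
have Hk k : forall y, lower_central (n + k) y -> lower_central (n + k).+1 (y ^+ e).
  elim: k => [|k IH]; first by rewrite addn0.
  by rewrite addnS; apply: lower_central_exponentS.
(* Climbing back from a term inside [U]: if [y] is one term higher, then [y ^+ e] and some
   [y ^+ (p ^ j)] are in [U], and their exponents are coprime. *)
suff sub k : @lower_central G (n + k) `<=` U -> @lower_central G n `<=` U.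
  apply: (sub m) => //; apply: subset_trans Lm.
  by apply: (chain_leq lower_centralS); rewrite leq_addl.
elim: k => [|k IH]; first by rewrite addn0.
rewrite addnS => subk; apply: IH => y Ly; have [j Uj] := tU y.
apply: (subgroup_coprime hU _ (subk _ (Hk _ _ Ly)) Uj).
by rewrite coprime_sym coprimeXl // prime_coprime // gtnNdvd.
Qed.

Lemma induces_nilpotent : nilpotent G.
Proof.
have [n [e [e0 He]]] := chain_exponent lower_central_normal lower_centralS vpG.
exact: (chain_trivial lower_central_normal lower_centralS vpG
  lower_central_residual (lower_central_torsion e0 He)).
Qed.

End Induces.

End LowerCentral.

Theorem theoremC (G : groupType) (hG : virtually_polycyclic G) :
  nilpotent G <->
  (forall (S : {pred G}) (H : subGroupType S) (p : nat),
     prime p -> induces_full_pro_p p H).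
Proof.
split=> [nilG S H p pp|ind]; last exact: induces_nilpotent.
apply/(induces_full_pro_pP H pp) => N nN qN.
have [hN _ _] := nN; have [_ tN] := (finite_p_quotientP pp nN).1 qN.
have valM : {morph (val : H -> G) : x y / x * y}.
  by move=> x y; rewrite gmulfM.
(* Separation is about subsets of [G], so [H] and [N] are replaced by their images under [val]. *)
have image_subgroup (A : set H) : subgroup A -> subgroup [set val h | h in A].
  move=> hA; apply/subgroupP; split=> [|_ _ [h Ah <-] [k Ak <-]|_ [h Ah <-]].
  - by exists 1; [apply: subgroup1 | rewrite morph_1].
  - by exists (h * k); [apply: subgroupM | rewrite valM].
  - by exists h^-1; [apply: subgroupV | rewrite morph_V].
have pN g : [set val h | h in @setT H] g ->
    exists j, [set val h | h in N] (g ^+ (p ^ j)).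
  move=> [h _ <-]; have [j Nj] := tN h; exists j, (h ^+ (p ^ j)) => //.
  by rewrite morph_X.
have [//|U [nU qU UN]] := nilpotent_separation pp
  (image_subgroup _ (@subgroupT H)) (image_subgroup _ hN) _ pN hG nilG.
  by move=> _ [h _ <-]; exists h.
exists U; split=> // h Uh; have [|k Nk] := UN (val h); last by move=> /val_inj <-.
by split=> //; exists h.
Qed.
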